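(* Let $0\le\delta\le 0.011$ and let $\mathcal{I}$ be a $\delta$-ONI instance with $n$ agents such that $|N^1_1|\le n\left(\frac14-\delta\right)/\left(\frac14+\frac{\delta}{3}\right)$. Then Algorithm $\mathtt{approxMMS1}(\mathcal{I},\delta)$ (for every resolution of its arbitrary choices) returns a $\left(\frac34+\delta\right)$-MMS allocation of $\mathcal{I}$.
   Context: An instance has agents $N=[n]$, goods $M$, additive valuations $v_i:2^M\to\mathbb{R}_{\ge0}$; $\mathrm{MMS}^d_v(S)$ is the max over partitions of $S$ into $d$ bundles of the minimum bundle value, $\mathrm{MMS}_i=\mathrm{MMS}^n_{v_i}(M)$; an allocation (disjoint bundles $A_i$) is $\beta$-MMS if $v_i(A_i)\ge\beta\mathrm{MMS}_i$ for all $i$. Ordered: $M=[m]$ and $v_i(1)\ge\dots\ge v_i(m)$ for all $i$. Normalized: every agent $i$ has an MMS partition all of whose $n$ bundles have value exactly $1$ to $i$ (so $\mathrm{MMS}_i=1$). For an ordered instance with $n$ agents and threshold $\alpha$, the instance is $\alpha$-irreducible if for every agent $i$: $v_i(1)<\alpha$, $v_i(\{2n-1,2n,2n+1\})<\alpha$, $v_i(\{3n-2,3n-1,3n,3n+1\})<\alpha$ and $v_i(\{1,2n+1\})<\alpha$. It is $\delta$-ONI if ordered, normalized and $(3/4+\delta)$-irreducible. Goods with index larger than $m$, when referred to, are dummy goods of value $0$. Let $B_k=\{k,2n-k+1\}$ for $k\in[n]$; $N^1=\{i: v_i(B_k)\le1\text{ for all }k\in[n]\}$, $N^2=N\setminus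 N^1$, $N^1_1=\{i\in N^1: v_i(2n+1)\ge\frac14-5\delta\}$, $N^1_2=N^1\setminus N^1_1$ (computed on the input instance and fixed). Algorithm $\mathtt{approxMMS1}(\mathcal{I},\delta)$: let $\alpha=3/4+\delta$ and start with bags $B_1,\dots,B_n$, all agents and bags unassigned. Phase 1: while some unassigned agent $i$ and unassigned bag $B$ satisfy $v_i(B)\ge\alpha$, assign such a bag $B$ to an agent $i$ with $v_i(B)\ge\alpha$, choosing an agent of $N^1_1$ whenever one qualifies. Phase 2: process the remaining bags one by one; for the current bag $B$, while no unassigned agent values $B$ at least $\alpha$, add to $B$ an arbitrary not-yet-used good outside $[2n]$; then assign $B$ to an unassigned agent $i$ with $v_i(B)\ge\alpha$, choosing an agent of $N^1_1$ whenever one qualifies. The output gives each agent the bag assigned to it. *)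

(* Defs.v *)
From HB Require Import structures.
From mathcomp Require Import all_boot all_order all_algebra.
Set Implicit Arguments. Unset Strict Implicit. Unset Printing Implicit Defensive.
Import Order.TTheory GRing.Theory Num.Theory.
Local Open Scope ring_scope.

(* Conventions.  Agents are 'I_n.  Goods are 'I_m, where the ordinal g
   represents the paper's good number g+1 (so M = {1,...,m}).  A valuation
   profile is v : 'I_n -> 'I_m -> R giving v_i of each single good; v_i of a
   bundle is the (additive) sum.  A paper index j > m refers to a dummy good of
   value 0: [items s] is the set of actual goods whose paper index is in s, so
   dummy indices simply contribute nothing. *)

Section Defs.
Variables (R : realFieldType) (n m : nat).
Implicit Types (v : 'I_n -> 'I_m -> R) (w : 'I_m -> R) (S : {set 'I_m}).

Definition items (s : seq nat) : {set 'I_m} := [set g : 'I_m | (g.+1 \in s)%N].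

Definition bval w S : R := \sum_(g in S) w g.

(* MMS^d_w(S): max over partitions of S into d bundles (f assigns each good of
   S to a bundle) of the minimum bundle value.  Valuations are nonnegative, so
   0 is neutral for the max and w(S) is neutral for the min. *)
Definition mms (d : nat) w S : R :=
  \big[Num.max/0]_(f : {ffun 'I_m -> 'I_d})
     \big[Num.min/bval w S]_(j < d) bval w [set g in S | f g == j].

Definition MMS v (i : 'I_n) : R := mms n (v i) setT.

Definition bundle (f : {ffun 'I_m -> 'I_n}) (j : 'I_n) : {set 'I_m} :=
  [set g | f g == j].

Definition is_beta_MMS v (beta : R) (A : 'I_n -> {set 'I_m}) : Prop :=
  (forall i j : 'I_n, i != j -> [disjoint A i & A j]) /\
  (forall i : 'I_n, beta * MMS v i <= bval (v i) (A i)).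

Definition nonneg_vals v : Prop := forall i g, 0 <= v i g.

Definition ordered v : Prop :=
  forall i (g1 g2 : 'I_m), (g1 <= g2)%N -> v i g2 <= v i g1.

Definition normalized v : Prop :=
  forall i : 'I_n, exists f : {ffun 'I_m -> 'I_n},
    \big[Num.min/bval (v i) setT]_(j < n) bval (v i) (bundle f j) = MMS v i
    /\ forall j, bval (v i) (bundle f j) = 1.

Definition irreducible v (alpha : R) : Prop :=
  forall i : 'I_n,
    [/\ bval (v i) (items [:: 1%N]) < alpha,
        bval (v i) (items [:: (2*n - 1)%N; (2*n)%N; (2*n+1)%N]) < alpha,
        bval (v i) (items [:: (3*n - 2)%N; (3*n - 1)%N; (3*n)%N; (3*n+1)%N]) < alpha
      & bval (v i) (items [:: 1%N; (2*n+1)%N]) < alpha].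

(* delta-ONI: ordered, normalized, (3/4+delta)-irreducible (with the standing
   assumption that valuations are nonnegative) *)
Definition ONI v (delta : R) : Prop :=
  [/\ nonneg_vals v, ordered v, normalized v & irreducible v (3/4 + delta)].

(* B_k = {k, 2n-k+1}; bag k : 'I_n is the paper's B_{k+1} = {k+1, 2n-k} *)
Definition bagB (k : 'I_n) : {set 'I_m} := items [:: k.+1; (2*n - k)%N].

Definition N1 v : {set 'I_n} := [set i | [forall k, bval (v i) (bagB k) <= 1]].
Definition N11 v (delta : R) : {set 'I_n} :=
  [set i in N1 v | 1/4 - 5 * delta <= bval (v i) (items [:: (2*n+1)%N])].

Record state := State {
  phase2 : bool;
  cur    : option 'I_n;              (* bag currently processed in Phase 2 *)
  bags   : 'I_n -> {set 'I_m};
  asg    : 'I_n -> option 'I_n       (* bag assigned to each agent *)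
}.

Definition upd (T : Type) (f : 'I_n -> T) (x : 'I_n) (y : T) : 'I_n -> T :=
  fun z => if z == x then y else f z.

Definition init_state : state := State false None bagB (fun _ => None).

Definition agent_free (s : state) (i : 'I_n) : bool := asg s i == None.
Definition bag_free (s : state) (k : 'I_n) : bool := [forall i, asg s i != Some k].

Section Step.
Variables (v : 'I_n -> 'I_m -> R) (delta : R).
Let alpha := 3/4 + delta.

Definition may_receive (s : state) (i k : 'I_n) : Prop :=
  [/\ agent_free s i, alpha <= bval (v i) (bags s k) &
      (forall i', i' \in N11 v delta -> agent_free s i' ->
         alpha <= bval (v i') (bags s k) -> i \in N11 v delta)].

Inductive step : state -> state -> Prop :=
| step_phase1 s k i :
    ~~ phase2 s -> bag_free s k -> may_receive s i k ->
    step s (State false None (bags s) (upd (asg s) i (Some k)))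
| step_to_phase2 s :
    ~~ phase2 s ->
    (forall i k, agent_free s i -> bag_free s k -> bval (v i) (bags s k) < alpha) ->
    step s (State true None (bags s) (asg s))
| step_pick s k :
    phase2 s -> cur s = None -> bag_free s k ->
    step s (State true (Some k) (bags s) (asg s))
| step_add s k (g : 'I_m) :
    phase2 s -> cur s = Some k ->
    (forall i, agent_free s i -> bval (v i) (bags s k) < alpha) ->
    (2*n < g.+1)%N -> (forall k', g \notin bags s k') ->
    step s (State true (Some k) (upd (bags s) k (g |: bags s k)) (asg s))
| step_assign s k i :
    phase2 s -> cur s = Some k -> may_receive s i k ->
    step s (State true None (bags s) (upd (asg s) i (Some k))).

Inductive reach : state -> state -> Prop :=
| reach_refl s : reach s s
| reach_step s t u : step s t -> reach t u -> reach s u.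

End Step.

Definition terminated (s : state) : Prop :=
  phase2 s /\ cur s = None /\ (forall k, ~~ bag_free s k).

Definition output (s : state) (i : 'I_n) : {set 'I_m} :=
  if asg s i is Some k then bags s k else set0.

End Defs.

(* Main.v *)
Require Import Defs.
From HB Require Import structures.
From mathcomp Require Import all_boot all_order all_algebra.
From mathcomp Require Import zify ring lra.
Set Implicit Arguments. Unset Strict Implicit. Unset Printing Implicit Defensive.
Import Order.TTheory GRing.Theory Num.Theory.
Local Open Scope ring_scope.

(** If the algorithm were stuck on a bag, all goods would be in bags, and for any
    unassigned agent i the values of the n bags would add up to n.  This is
    refuted by bounding the bags, with alpha = 3/4 + delta:
    - i in N^1_1: by the priority rule, i values below alpha every bag not given
      to N^1_1, and the others are worth at most 4 alpha / 3; the bound on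
      |N^1_1| makes the sum less than n;
    - i in N^1_2: every bag is worth at most 1, the current one less than alpha;
    - i in N^2: let l be the last bag worth more than 1 and k1 the first.  In the
      partition into bundles of value 1, the goods up to l lie in distinct
      bundles; the other bundles contain 2 (n - l - 1) + c goods among the first
      2n - k1, all worth at least y = 1 - v_i(1), for some surplus c >= 1 (indices
      from 0).  Pigeonhole shows that good k and the good c places after its
      partner are worth at most 1 together, so the total excess of the bags above 1
      telescopes to at most c (1/3 - y).  On the other hand the bags after l
      lose c y, and even if those below alpha are filled up again, enough of
      this loss remains. *)

(** * Additive valuations and the values of goods by index *)

Section Valuation.
Variables (R : realFieldType) (m : nat) (w : 'I_m -> R).
Hypothesis w_ge0 : forall g, 0 <= w g.
Implicit Types S T : {set 'I_m}.

Lemma bval_ge0 S : 0 <= bval w S.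
Proof. exact: sumr_ge0. Qed.

Lemma bvalU S T : [disjoint S & T] -> bval w (S :|: T) = bval w S + bval w T.
Proof.
by move=> dST; rewrite /bval -bigU //; apply: eq_bigl => g; rewrite !inE.
Qed.

Lemma bval_le S T : S \subset T -> bval w S <= bval w T.
Proof.
move=> /setIidPr ST; rewrite /bval [leRHS](big_setID S) /= ST lerDl.
exact: sumr_ge0.
Qed.

Lemma bval_ge_card S y : (forall g, g \in S -> y <= w g) -> #|S|%:R * y <= bval w S.
Proof.
by move=> yS; rewrite mulr_natl -sumr_const; apply: ler_sum.
Qed.

Lemma bvalU1_le S g : bval w (g |: S) <= w g + bval w S.
Proof.
have [gS|gS] := boolP (g \in S); last by rewrite /bval big_setU1.
by rewrite (setUidPr _) ?sub1set // lerDr.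
Qed.

Lemma bval_cover (I : finType) (A : I -> {set 'I_m}) :
  (forall g, exists k, g \in A k) -> bval w setT <= \sum_k bval w (A k).
Proof.
move=> cov; rewrite /bval (exchange_big_dep predT) //= [leLHS](eq_bigl predT) //=; last first.
  by move=> g; rewrite in_setT.
apply: ler_sum => g _; have [k gk] := cov g.
by rewrite (bigD1 k) //= lerDl; apply: sumr_ge0.
Qed.

Lemma bval_preim (I : finType) (f : 'I_m -> I) (J : {set I}) :
  bval w (f @^-1: J) = \sum_(j in J) bval w [set g | f g == j].
Proof.
rewrite /bval (partition_big f (mem J)) /=; last by move=> g; rewrite inE.
apply: eq_bigr => j jJ; apply: eq_bigl => g; rewrite !inE.
by case: eqP => [->|]; rewrite ?jJ ?andbF.
Qed.

Lemma bval_items s : uniq s -> bval w (items m s) = \sum_(j <- s) bval w (items m [:: j]).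
Proof.
elim: s => [_|a s IHs /= /andP[a_s /IHs Es]].
  by rewrite big_nil /bval big_pred0 // => g; rewrite inE.
rewrite big_cons -Es -bvalU; last first.
  rewrite disjoints_subset; apply/subsetP => g; rewrite !inE => /eqP ->.
  exact: a_s.
by congr bval; apply/setP => g; rewrite !inE.
Qed.

(* Zero-based: [gval j] is the value of the paper's good [j + 1]. *)
Definition gval (j : nat) : R := bval w (items m [:: j.+1]).

Lemma gvalE (g : 'I_m) : gval g = w g.
Proof.
rewrite /gval /bval (big_pred1 g) // => h; rewrite !inE eqSS.
by rewrite -val_eqE.
Qed.

Lemma gval_ge0 j : 0 <= gval j. Proof. exact: bval_ge0. Qed.

Lemma gval_dummy j : (m <= j)%N -> gval j = 0.
Proof.
move=> mj; rewrite /gval /bval big_pred0 // => g; rewrite !inE.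
by apply/negbTE/eqP; have := ltn_ord g; lia.
Qed.

Lemma gval_gt0_lt j : 0 < gval j -> (j < m)%N.
Proof. by move=> gj; rewrite ltnNge; apply/negP => /gval_dummy gj0; lra. Qed.

Lemma bval_range a b :
  bval w [set g : 'I_m | (a <= g < b)%N] = \sum_(a <= j < b) gval j.
Proof.
transitivity (bval w (items m (index_iota a.+1 b.+1))).
  by congr bval; apply/setP => g; rewrite !inE mem_index_iota !ltnS.
by rewrite bval_items ?iota_uniq // big_add1.
Qed.

Lemma bval_bagB n (k : 'I_n) :
  bval w (bagB m k) = gval k + gval (2 * n - 1 - k).
Proof.
have kn := ltn_ord k.
rewrite /bagB bval_items /=; last by rewrite inE; lia.
rewrite !big_cons big_nil addr0 /gval; congr (_ + bval w (items m [:: _])).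
lia.
Qed.

Hypothesis w_ord : forall g h : 'I_m, (g <= h)%N -> w h <= w g.

Lemma gval_le i j : (i <= j)%N -> gval j <= gval i.
Proof.
move=> ij; have [jm|/gval_dummy ->] := ltnP j m; last exact: gval_ge0.
by rewrite -[j]/(val (Ordinal jm)) gvalE -[i]/(val (Ordinal (leq_ltn_trans ij jm)))
   gvalE w_ord.
Qed.

End Valuation.

(** * Counting and summation tools *)

Lemma card_ord_range m a b : (b <= m)%N ->
  #|[set g : 'I_m | (a <= g < b)%N]| = (b - a)%N.
Proof.
(* The cardinality is the value of the range under the constant valuation 1. *)
move=> bm; have := @bval_range rat m (fun=> 1) a b.
rewrite /bval sumr_const (eq_big_nat _ _ (F2 := fun=> 1)); last first.
  by move=> j /andP[_ jb]; rewrite -[j]/(val (Ordinal (leq_trans jb bm))) gvalE.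
by rewrite sumr_const_nat => /eqP; rewrite eqr_nat => /eqP.
Qed.

Lemma card_le_fibers (S J : finType) (A : {set S}) (B : {set J}) (f : S -> J) d :
  (forall g, g \in A -> f g \in B) ->
  (forall j, j \in B -> (#|[set g in A | f g == j]| <= d)%N) ->
  (#|A| <= #|B| * d)%N.
Proof.
move=> fA fib; rewrite -sum1_card (partition_big f (mem B)) //=.
rewrite -sum_nat_const; apply: leq_sum => j jB.
rewrite sum1dep_card; apply: leq_trans (fib j jB); apply: subset_leq_card.
by apply/subsetP => g; rewrite !inE.
Qed.

(** Splitting the sum of q over the first [c + N] indices at c and at N relates the two sides, so N
    may be smaller than c. *)
Lemma telescope_shift (R : zmodType) (q : nat -> R) N c :
  \sum_(j < N) (q (j + c)%N - q j) = \sum_(j < c) (q (N + j)%N - q j).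
Proof.
rewrite !sumrB; apply/eqP; rewrite subr_eq addrAC eq_sym subr_eq eq_sym; apply/eqP.
transitivity (\sum_(j < c + N) q j).
  by rewrite big_split_ord /= addrC; congr (_ + _); apply: eq_bigr => j _; rewrite addnC.
by rewrite addnC big_split_ord /= addrC.
Qed.

(** * The bags as valued by an agent of N^2 *)

Section LargeBag.
Variables (R : realFieldType) (n m : nat) (w : 'I_m -> R).
Variables (f : {ffun 'I_m -> 'I_n}) (delta : R) (k1 l : nat).
Hypothesis w_ge0 : forall g, 0 <= w g.
Hypothesis w_ord : forall g h : 'I_m, (g <= h)%N -> w h <= w g.
Hypothesis f1 : forall j, bval w (bundle f j) = 1.
Hypotheses (delta_ge0 : 0 <= delta) (delta_le : delta <= 11 / 1000).

Local Notation W := (gval w).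
Local Notation alpha := (3 / 4 + delta).
Local Notation bag k := (W k + W (2 * n - 1 - k)).
(** In the application, x exceeds the value of every good after the first 2n, by irreducibility for
    the pair of goods 1 and 2n+1. *)
Local Notation x := (alpha - W 0).
Local Notation y := (1 - W 0).

Hypothesis W0_lt : W 0 < alpha.
Hypotheses (k1_le : (k1 <= l)%N) (l_lt : (l < n)%N).
Hypotheses (bag_k1 : 1 < bag k1) (bag_l : 1 < bag l).
Hypothesis bag_low : forall k, (k < k1)%N -> bag k <= 1.
Hypothesis bag_high : forall k, (l < k < n)%N -> bag k <= 1.

Let Wle := gval_le w_ge0 w_ord.

Lemma bundle_sub_le1 (S : {set 'I_m}) j :
  (forall g, g \in S -> f g = j) -> bval w S <= 1.
Proof.
move=> Sj; rewrite -(f1 j); apply: bval_le => //.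
by apply/subsetP => g /Sj gj; rewrite inE gj.
Qed.

(** A common bundle would be worth at least [W a + W b], but bundles are worth 1. *)
Lemma pair_separated a b (g h : 'I_m) : 1 < W a + W b ->
  (g <= a)%N -> (h <= b)%N -> g != h -> f g != f h.
Proof.
move=> ab ga hb gh; apply/eqP => fgh.
have : bval w [set g; h] <= 1.
  by apply: (@bundle_sub_le1 _ (f h)) => u; rewrite !inE => /orP[] /eqP ->.
rewrite /bval big_setU1 ?inE //= big_set1.
by have := Wle ga; have := Wle hb; rewrite !gvalE; lra.
Qed.

Lemma y_le j : (j <= 2 * n - 1 - k1)%N -> y <= W j.
Proof. by move/Wle; have := Wle (leq0n k1); have := bag_k1; lra. Qed.

Lemma y_gt : 1 / 4 - delta < y.
Proof. by have := W0_lt; lra. Qed.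

(** The partner of good k1 is worth at least y > 0, so it is no dummy. *)
Lemma goods_bound : (2 * n - k1 <= m)%N.
Proof.
have: (2 * n - 1 - k1 < m)%N; last lia.
apply: (@gval_gt0_lt _ _ w); have := y_le (leqnn _); have := y_gt; have := delta_le; have := delta_ge0; lra.
Qed.

Definition top_bundles : {set 'I_n} := f @: [set g : 'I_m | (g <= l)%N].

Lemma card_top_bundles : #|top_bundles| = l.+1.
Proof.
rewrite card_in_imset => [|g h]; last first.
  rewrite !inE => gl hl /eqP fgh; apply/eqP; apply: contraTT fgh => gh.
  by apply: (pair_separated bag_l) => //; lia.
rewrite -[RHS]subn0 -(@card_ord_range m); last by have := goods_bound; lia.
by apply: eq_card => g; rewrite !inE.
Qed.

Lemma middle_outside (g : 'I_m) :
  (l < g <= 2 * n - 1 - l)%N -> f g \notin top_bundles.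
Proof.
move=> /andP[lg gl]; apply/imsetP => -[h]; rewrite inE => hl.
by apply/eqP; rewrite eq_sym; apply: (pair_separated bag_l) => //; apply/eqP => hg; subst; lia.
Qed.

(* The [2 (n - l) - 1] goods strictly after [l], up to the partner of [l], lie
   in the [n - l - 1] remaining bundles, so three of them share a bundle. *)
Lemma partner_le_third : 3 * W (2 * n - 1 - l) <= 1.
Proof.
rewrite leNgt; apply/negP => W3.
have := @card_le_fibers _ _ [set g : 'I_m | (l < g < 2 * n - l)%N] (~: top_bundles) f 2.
have := goods_bound => bm.
rewrite card_ord_range; last by lia.
rewrite cardsCs setCK card_ord card_top_bundles => H.
suff: (2 * n - l - l.+1 <= (n - l.+1) * 2)%N by lia.
apply: H => [g|j _].
  by rewrite !inE => /andP[lg gl]; apply: middle_outside; lia.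
set F := [set g in _ | _].
have F1 : bval w F <= 1 by apply: (@bundle_sub_le1 _ j) => g; rewrite !inE => /andP[_ /eqP].
have : #|F|%:R * W (2 * n - 1 - l) <= bval w F.
  apply: bval_ge_card => g; rewrite !inE => /andP[/andP[_ gl] _].
  by rewrite -gvalE; apply: Wle; lia.
rewrite leqNgt => F2; apply/negP => F3.
have : (3 : R) <= #|F|%:R by rewrite ler_nat.
nra.
Qed.

Lemma top_gt : 2 / 3 < W l.
Proof. by have := partner_le_third; have := bag_l; lra. Qed.

Lemma x_le : x <= 1 / 12 + delta.
Proof. by have := top_gt; have := Wle (leq0n l); lra. Qed.

Definition rest_goods : {set 'I_m} :=
  [set g : 'I_m | (g < 2 * n - k1)%N & f g \notin top_bundles].

Definition middle_goods : {set 'I_m} :=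
  [set g : 'I_m | (l.+1 <= g < 2 * n - 1 - l)%N].

Definition surplus := (#|rest_goods| - 2 * (n - l.+1))%N.
Local Notation c := surplus.

(** The goods from l+1 to the partner of l all belong to [rest_goods], and there are
    [2 (n - l - 1) + 1] of them; so the truncated subtraction in [surplus] is exact. *)
Lemma surplus_spec : (0 < c)%N /\ #|rest_goods| = (2 * (n - l.+1) + c)%N.
Proof.
suff: (2 * n - l - l.+1 <= #|rest_goods|)%N by rewrite /c; lia.
rewrite -(@card_ord_range m); last by have := goods_bound; lia.
apply: subset_leq_card; apply/subsetP => g; rewrite !inE => /andP[lg gl].
by rewrite middle_outside; lia.
Qed.

(** Three goods in F would include two other than h; with h, they would be worth more than
    [2/3 + 2 (1/4 - delta) > 1] in one bundle. *)
Lemma top_fiber_card (F : {set 'I_m}) (h : 'I_m) :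
  (h <= l)%N -> (forall g, g \in F -> (g < 2 * n - k1)%N /\ f g = f h) ->
  (#|F| <= 2)%N.
Proof.
move=> hl Fh; rewrite leqNgt; apply/negP => F3.
have F2 : (2 <= #|F :\ h|)%N by move: F3; rewrite (cardsD1 h F); case: (h \in F) => // /ltnW.
have : bval w (h |: F :\ h) <= 1.
  apply: (@bundle_sub_le1 _ (f h)) => g; by rewrite !inE => /orP[/eqP -> //|/andP[_ /Fh[]//]].
rewrite bvalU; last by rewrite disjoints1 !inE eqxx.
have -> : bval w [set h] = W h by rewrite /bval big_set1 gvalE.
have : #|F :\ h|%:R * y <= bval w (F :\ h).
  apply: bval_ge_card => g; rewrite !inE => /andP[_ /Fh[gk _]].
  by rewrite -gvalE; apply: y_le; lia.
have : (2 : R) <= #|F :\ h|%:R by rewrite ler_nat.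
by have := Wle hl; have := top_gt; have := y_gt; have := delta_le; nra.
Qed.

(* Otherwise the bundles of goods [0..k] contain no other good up to
   [2n - 1 - k + c]; the [2n - 1 - 2k + c] goods in between do not fit, two per
   bundle, into the bundles of goods [k+1..l] and the rest. *)
Lemma shifted_pair_le1 k : (k1 + c <= k <= l)%N -> W k + W (2 * n - 1 - k + c) <= 1.
Proof.
move=> /andP[k1k kl]; rewrite leNgt; apply/negP => big_pair.
have [c0 cE] := surplus_spec; have bm := goods_bound.
pose A := [set g : 'I_m | (k.+1 <= g < 2 * n - k + c)%N].
have cardA : #|A| = (2 * n - k + c - k.+1)%N by rewrite card_ord_range; lia.
pose D := [set g : 'I_m | (k.+1 <= g < l.+1)%N].
have cardD : #|D| = (l.+1 - k.+1)%N by rewrite card_ord_range; lia.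
pose A' := [set g in A | f g \in top_bundles].
have A'_le : (#|A'| <= #|f @: D| * 2)%N.
  apply: (card_le_fibers (f := f)) => [g|j].
    rewrite !inE => /andP[/andP[kg gk] /imsetP[h]]; rewrite inE => hl gh.
    rewrite gh imset_f // inE ltnS hl andbT ltnNge; apply/negP => hk.
    suff : f h != f g by rewrite gh eqxx.
    by apply: (pair_separated big_pair) => //; [lia|apply/eqP => E; subst; lia].
  move=> /imsetP[h]; rewrite inE => /andP[_ hl] ->.
  (* Since [k1 + c <= k], the goods of A stay below [2 n - k1]. *)
  by apply: (@top_fiber_card _ h) => // g; rewrite !inE => /andP[/andP[/andP[_ ?] _] /eqP ->]; split=> //; lia.
have D_le : (#|f @: D| <= l.+1 - k.+1)%N by rewrite -cardD leq_imset_card.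
have A_le : (#|A| <= #|rest_goods| + #|A'|)%N.
  apply: (@leq_trans #|rest_goods :|: A'|); last by rewrite cardsU leq_subr.
  apply: subset_leq_card; apply/subsetP => g gA; rewrite in_setU !inE.
  have [fg|fg] := boolP (f g \in top_bundles); move: gA; rewrite inE => /andP[kg gk].
    by rewrite kg gk orbT.
  by rewrite andbT; apply/orP; left; lia.
(* The available room is [2 (n - l - 1) + c + 2 (l - k)], one less than the size of A. *)
move: A_le; rewrite cardA cE; lia.
Qed.

(** The [n - l - 1] bundles outside [top_bundles] are worth 1 each; they contain [rest_goods], that
    is the [2 (n - l - 1)] middle goods and c more, each worth at least y. *)
Lemma middle_goods_le : \sum_(l.+1 <= j < 2 * n - 1 - l) W j + c%:R * y <= (n - l.+1)%:R.
Proof.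
have [c0 cE] := surplus_spec; have bm := goods_bound.
have midS : middle_goods \subset rest_goods.
  apply/subsetP => g; rewrite !inE => /andP[lg gl].
  by rewrite middle_outside; lia.
have restE : rest_goods = middle_goods :|: rest_goods :\: middle_goods.
  by rewrite setDE setUIr setUCr setIT; apply/esym/setUidPr.
have cardD : #|rest_goods :\: middle_goods| = c.
  by rewrite cardsD (setIidPr midS) cE card_ord_range; lia.
have rest_le : bval w rest_goods <= (n - l.+1)%:R.
  apply: (@le_trans _ _ (bval w (f @^-1: ~: top_bundles))).
    by apply: bval_le => //; apply/subsetP => g; rewrite !inE => /andP[].
  rewrite bval_preim (eq_bigr (fun=> 1)) => [|j _]; last exact: f1.
  by rewrite sumr_const cardsCs setCK card_ord card_top_bundles.
apply: le_trans rest_le; rewrite restE bvalU; last first.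
  by rewrite -setI_eq0 setDE setICA setICr setI0.
rewrite bval_range -cardD lerD2l; apply: bval_ge_card => g.
by rewrite !inE => /andP[_ /andP[gk _]]; rewrite -gvalE; apply: y_le; lia.
Qed.

Lemma sum_high_bags : \sum_(l.+1 <= k < n) bag k = \sum_(l.+1 <= j < 2 * n - 1 - l) W j.
Proof.
rewrite big_split /= [RHS](@big_cat_nat _ _ _ n) /=; [|lia..].
congr (_ + _); have nE : n = (l.+1 + (n - l.+1))%N by lia.
rewrite [X in _ = \sum_(X <= _ < _) _]nE big_addn big_nat_rev /=.
have -> : (2 * n - 1 - l - (n - l.+1) = n)%N by lia.
by apply: eq_big_nat => k kn; congr gval; lia.
Qed.

(* Bags below [alpha] may later be filled up to [alpha + x]. *)
Definition final_bound k : R := if bag k < alpha then alpha + x else bag k.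

Lemma final_bound_le1 k : bag k <= 1 -> final_bound k <= 1.
Proof.
by rewrite /final_bound; case: ifP => // _ _; have := x_le; have := delta_le; lra.
Qed.

Lemma sum_low_bounds :
  \sum_(0 <= k < l.+1) final_bound k <= l.+1%:R + c%:R * (1 / 3 - y).
Proof.
have [c0 _] := surplus_spec.
rewrite (@big_cat_nat _ _ _ k1) //=; last by lia.
have low : \sum_(0 <= k < k1) final_bound k <= k1%:R.
  rewrite -[leRHS]mulr1 mulr_natl -[in leRHS](subn0 k1) -sumr_const_nat.
  by apply: ler_sum_nat => k /andP[_ kk]; apply/final_bound_le1/bag_low.
(* The partners of k1, k1+1, ..., preceded by c copies of y. Bag [k1 + j] exceeds 1 by at most
   [q (j + c) - q j]: for [j < c] because good [k1 + j] is worth at most [1 - y], otherwise by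
   [shifted_pair_le1]. These differences are nonnegative, which covers the filled bags. *)
pose q j := if (j < c)%N then y else W (2 * n - 1 - (k1 + j - c)).
suff: \sum_(k1 <= k < l.+1) final_bound k <= (l.+1 - k1)%:R + c%:R * (1 / 3 - y).
  by rewrite natrB; [lra|lia].
rewrite -{1}[k1]add0n big_addn big_mkord.
apply: (@le_trans _ _ (\sum_(j < l.+1 - k1) (1 + (q (j + c)%N - q j)))).
  apply: ler_sum => j _; have jl := ltn_ord j.
  have qc : q (j + c)%N = W (2 * n - 1 - (j + k1)).
    by rewrite /q ltnNge leq_addl /=; congr gval; lia.
  rewrite qc {qc} /q; case: ltnP => cj.
    have := @y_le (2 * n - 1 - (j + k1)) ltac:(lia).
    have := Wle (leq0n (j + k1)).
    rewrite /final_bound; case: ifP => _; first have := x_le; have := delta_le; lra.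
  have := @shifted_pair_le1 (j + k1) ltac:(lia).
  have -> : (2 * n - 1 - (j + k1) + c = 2 * n - 1 - (k1 + j - c))%N by lia.
  have := @Wle (2 * n - 1 - (j + k1)) (2 * n - 1 - (k1 + j - c)) ltac:(lia).
  rewrite /final_bound; case: ifP => _; first have := x_le; have := delta_le; lra.
(* What remains is c late values of q, each at most 1/3, minus c copies of y. *)
rewrite big_split /= sumr_const card_ord lerD2l telescope_shift.
rewrite mulr_natl -[in leRHS](card_ord c) -sumr_const; apply: ler_sum => j _.
have jc := ltn_ord j.
rewrite /q jc lerD2r; case: ltnP => _.
  by have := partner_le_third; have := @y_le (2 * n - 1 - l) ltac:(lia); lra.
have := partner_le_third.
have := @Wle (2 * n - 1 - l) (2 * n - 1 - (k1 + (l.+1 - k1 + j) - c)) ltac:(lia); lra.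
Qed.

Local Notation lam := (1 / 4 - delta - x).
Local Notation mu := (1 / 4 + 3 * delta - x).

(* For a bag below [alpha], [lam] is the gap of its bound [alpha + x] to [1] and
   [mu] bounds its growth (both its goods are worth at least [y]). *)
Lemma final_bound_convex k : (l < k < n)%N ->
  (lam + mu) * final_bound k <= lam * bag k + mu.
Proof.
move=> kn; have b1 := bag_high kn.
have yk := @y_le k ltac:(lia); have yk' := @y_le (2 * n - 1 - k) ltac:(lia).
have xle := x_le; have d0 := delta_ge0; have d1 := delta_le.
(* As [alpha + x = 1 - lam] and [2 y = 1 - lam - mu], the filled case is [2 y <= bag k] multiplied
   by [lam]. *)
rewrite /final_bound; case: ifP => _; nra.
Qed.

(** Filling up leaves at least the fraction [lam / (lam + mu)] of the loss [c y]. *)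
Lemma sum_high_bounds :
  (lam + mu) * \sum_(l.+1 <= k < n) final_bound k <=
  (lam + mu) * (n - l.+1)%:R - lam * (c%:R * y).
Proof.
have mid := middle_goods_le; rewrite -sum_high_bags in mid.
apply: (@le_trans _ _ (lam * (\sum_(l.+1 <= k < n) bag k) + mu * (n - l.+1)%:R)).
  have -> : mu * (n - l.+1)%:R = \sum_(l.+1 <= k < n) mu.
    by rewrite sumr_const_nat mulr_natr.
  rewrite !mulr_sumr -big_split /=.
  by apply: ler_sum_nat => k kn; apply: final_bound_convex.
have lam0 : 0 <= lam by have := x_le; have := delta_le; lra.
have := ler_wpM2l lam0 mid; lra.
Qed.

Lemma sum_final_bound_lt : \sum_(k < n) final_bound k < n%:R.
Proof.
have [c0 _] := surplus_spec.
have c1 : (0 : R) < c%:R by rewrite ltr0n.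
have xle := x_le; have d0 := delta_ge0; have d1 := delta_le.
have x0 : 0 < x by have := W0_lt; lra.
have lm : 0 < lam + mu by lra.
rewrite -(big_mkord xpredT final_bound) (@big_cat_nat _ _ _ l.+1) //=.
rewrite -(ltr_pM2l lm).
have low := ler_wpM2l (ltW lm) sum_low_bounds.
have high := sum_high_bounds; move: high; rewrite natrB // => high.
have key : (lam + mu) * (1 / 3 - y) < lam * y.
  (* In terms of the slack u of [x_le], [y = 1/3 - u], [lam = 1/6 - 2 delta + u] and
     [lam + mu = 1/3 + 2 u]; the upper bound on u comes from [x > 0]. *)
  pose u := 1 / 12 + delta - x.
  have u0 : 0 <= u by rewrite /u; lra.
  have u1 : u <= 1 / 12 + 11 / 1000 by rewrite /u; lra.
  have : lam * y - (lam + mu) * (1 / 3 - y) =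
      1 / 18 - 2 / 3 * delta + 2 * delta * u - u / 6 - 3 * u ^+ 2.
    by rewrite /u; field.
  have : 0 <= delta * u by exact: mulr_ge0.
  by nra.
have ck : c%:R * ((lam + mu) * (1 / 3 - y)) < c%:R * (lam * y) by rewrite ltr_pM2l.
lra.
Qed.

End LargeBag.

Lemma sum_large_bag_lt (R : realFieldType) (n m : nat) (w : 'I_m -> R)
    (f : {ffun 'I_m -> 'I_n}) (delta : R) (F : 'I_n -> R) (k0 : 'I_n) :
  (forall g, 0 <= w g) -> (forall g h : 'I_m, (g <= h)%N -> w h <= w g) ->
  (forall j, bval w (bundle f j) = 1) ->
  0 <= delta -> delta <= 11 / 1000 ->
  gval w 0 + gval w (2 * n) < 3 / 4 + delta ->
  (forall k, F k = bval w (bagB m k) \/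
     bval w (bagB m k) < 3 / 4 + delta /\ F k <= 3 / 4 + delta + gval w (2 * n)) ->
  1 < bval w (bagB m k0) -> \sum_k F k < n%:R.
Proof.
move=> w0 wle f1 d0 d1 W01 FE big0.
have W0_lt : gval w 0 < 3 / 4 + delta by have := gval_ge0 w0 (2 * n); lra.
(* k1 and l are the first and last bags worth more than 1. *)
case: (@arg_minnP _ k0 (fun k => 1 < bval w (bagB m k)) val big0) => k1 big1 min1.
case: (@arg_maxnP _ k0 (fun k => 1 < bval w (bagB m k)) val big0) => l bigl maxl.
rewrite bval_bagB in big1; rewrite bval_bagB in bigl.
have := @sum_final_bound_lt R n m w f delta k1 l w0 wle f1 d0 d1 W0_lt.
move=> /(_ (maxl k1 _) (ltn_ord l) big1 bigl) lt_n.
apply: le_lt_trans (lt_n _ _ _); last 3 first.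
- by rewrite bval_bagB.
- move=> k kk1; have kn := ltn_trans kk1 (ltn_ord k1).
  rewrite leNgt; apply/negP => bk; have := min1 (Ordinal kn).
  by rewrite bval_bagB => /(_ bk) /=; lia.
- move=> k /andP[lk kn]; rewrite leNgt; apply/negP => bk; have := maxl (Ordinal kn).
  by rewrite bval_bagB => /(_ bk) /=; lia.
apply: ler_sum => k _; rewrite /final_bound -bval_bagB.
by case: (FE k) => [->|[]]; case: ifP => //; lra.
Qed.

Lemma ltr_sum1 (R : numDomainType) (I : finType) (F G : I -> R) i0 :
  (forall i, F i <= G i) -> F i0 < G i0 -> \sum_i F i < \sum_i G i.
Proof.
move=> FG FG0; rewrite (bigD1 i0) //= [ltRHS](bigD1 i0) //=.
by apply: ltr_leD => //; apply: ler_sum.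
Qed.

(** * Counting agents against bags *)

Section Assignment.
Variables (n : nat) (a : 'I_n -> option 'I_n).

(** If every agent had a bag, the assignment would be an injection of ['I_n] into itself, hence
    onto, and would reach k. *)
Lemma free_bag_free_agent k :
  (forall i j k, a i = Some k -> a j = Some k -> i = j) ->
  (forall i, a i != Some k) -> exists i, a i == None.
Proof.
move=> inj free; apply/existsP; rewrite -[X in is_true X]negbK negb_exists.
apply/negP => /forallP assigned.
have aE i : a i = Some (odflt k (a i)) by case: (a i) (assigned i).
have hinj : injective (fun i => odflt k (a i)).
  by move=> i j E; apply: (inj _ _ _ (aE i)); rewrite E -aE.
have [h _ hK] := injF_bij hinj.
by have := free (h k); rewrite aE hK eqxx.
Qed.

Lemma full_bags_full_agents :
  (forall k, exists i, a i == Some k) -> forall i, exists k, a i = Some k.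
Proof.
move=> full i.
pose h k := xchoose (full k).
have hE k : a (h k) = Some k by apply/eqP/(xchooseP (full k)).
have hinj : injective h by move=> k k' E; have := hE k; rewrite E hE => -[].
by have [g _ hK] := injF_bij hinj; exists (g i); rewrite -[in LHS](hK i).
Qed.

End Assignment.

(** * Runs of the algorithm: termination and invariant *)

Section Run.
Variables (R : realFieldType) (n m : nat) (v : 'I_n -> 'I_m -> R) (delta : R).
Local Notation alpha := (3 / 4 + delta).
Local Notation st := (state n m).
Implicit Types (s t : st) (i j k : 'I_n).

Definition num_free (a : 'I_n -> option 'I_n) : nat := #|[set i | a i == None]|.

Definition num_unused (b : 'I_n -> {set 'I_m}) : nat :=
  #|[set g | [forall k, g \notin b k]]|.

(** An assignment or the change of phase may reset [cur] to [None], which adds 1; hence the weights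
    2. *)
Definition measure s : nat :=
  (2 * num_free (asg s) + (cur s == None) + 2 * (~~ phase2 s) + num_unused (bags s))%N.

Lemma agent_free_upd p q (b : 'I_n -> {set 'I_m}) s i k j :
  agent_free (State p q b (upd (asg s) i (Some k))) j = (j != i) && agent_free s j.
Proof. by rewrite /agent_free /upd /=; case: (j == i). Qed.

Lemma num_free_upd (a : 'I_n -> option 'I_n) i k : a i == None ->
  num_free a = (num_free (upd a i (Some k))).+1.
Proof.
move=> ai; rewrite /num_free (cardsD1 i) inE ai add1n; congr _.+1.
by apply: eq_card => j; rewrite !inE /upd; case: (j == i).
Qed.

Lemma num_unused_upd (b : 'I_n -> {set 'I_m}) k g : (forall k', g \notin b k') ->
  (num_unused (upd b k (g |: b k)) < num_unused b)%N.
Proof.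
move=> gN; apply: proper_card; apply/properP; split.
  apply/subsetP => h; rewrite !inE => /forallP hN; apply/forallP => k'.
  by have := hN k'; rewrite /upd; case: eqP => [->|//]; rewrite !inE negb_or => /andP[].
exists g; rewrite !inE; first by apply/forallP.
by apply/forallPn; exists k; rewrite /upd eqxx !inE eqxx.
Qed.

Lemma step_measure s t : step v delta s t -> (measure t < measure s)%N.
Proof.
case=> {s t} [s k i p1 fk [fi _ _]|s p1 _|s k p2 c0 _|s k g p2 c0 _ _ gN|s k i p2 c0 [fi _ _]];
  rewrite /measure /=.
- by rewrite (num_free_upd k fi) (negbTE p1); lia.
- by rewrite (negbTE p1); lia.
- by rewrite p2 c0 eqxx; lia.
- by rewrite p2 c0 /= ltn_add2l num_unused_upd.
- by rewrite (num_free_upd k fi) p2 c0 /=; lia.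
Qed.

Lemma step_wf s : Acc (fun t s => step v delta s t) s.
Proof.
have [N] := ubnP (measure s); elim: N s => [s|N IHN s sN]; first by rewrite ltn0.
by constructor => t st; apply: IHN; apply: leq_trans (step_measure st) sN.
Qed.

(** [inv_prio] records the priority rule. [inv_bag] speaks of agents still unassigned: they were
    unassigned at every addition, so the bag was below alpha for them just before its last good came
    in. *)
Record inv s : Prop := Inv {
  inv_disj : forall k k', k != k' -> [disjoint bags s k & bags s k'];
  inv_sub : forall k, bagB m k \subset bags s k;
  inv_inj : forall i j k, asg s i = Some k -> asg s j = Some k -> i = j;
  inv_val : forall i k, asg s i = Some k -> alpha <= bval (v i) (bags s k);
  inv_prio : forall i j k, agent_free s i -> i \in N11 v delta ->
    asg s j = Some k -> j \notin N11 v delta -> bval (v i) (bags s k) < alpha;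
  inv_bag : forall i k, agent_free s i -> bags s k = bagB m k \/
    bval (v i) (bagB m k) < alpha /\
    bval (v i) (bags s k) <= alpha + gval (v i) (2 * n);
  inv_phase1 : ~~ phase2 s -> cur s = None /\ forall k, bags s k = bagB m k;
  inv_cur : forall k, cur s = Some k -> bag_free s k;
  inv_free : forall k, bag_free s k -> cur s != Some k -> bags s k = bagB m k;
  inv_phase2 : phase2 s -> forall i k, agent_free s i -> bag_free s k ->
    bval (v i) (bagB m k) < alpha
}.

Lemma bagB_disjoint k k' : k != k' -> [disjoint bagB m k & bagB m k'].
Proof.
move=> kk'; rewrite disjoints_subset; apply/subsetP => g; rewrite !inE.
by have := ltn_ord k; have := ltn_ord k'; move: kk'; rewrite -val_eqE /=; lia.
Qed.

Lemma inv_init : inv (init_state n m).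
Proof.
split=> //=.
- exact: bagB_disjoint.
- by left.
Qed.

(** Serves the assignments of both phases, hence the two cases for [cur]. [inv_prio] for the new
    pair is the contrapositive of the last clause of [may_receive]. *)
Lemma inv_assign s i k : inv s -> bag_free s k -> may_receive v delta s i k ->
  cur s = None \/ cur s = Some k ->
  inv (State (phase2 s) None (bags s) (upd (asg s) i (Some k))).
Proof.
move=> I fk [fi vi prio] ck.
have updE j k' : upd (asg s) i (Some k) j = Some k' ->
    j = i /\ k' = k \/ [/\ j != i, asg s j = Some k' & k' != k].
  rewrite /upd; case: eqP => [-> [->]|_ E]; [by left|right; split=> //].
  by apply/eqP => kk; have /forallP/(_ j) := fk; rewrite E kk eqxx.
have freeE j : agent_free (State (phase2 s) None (bags s) (upd (asg s) i (Some k))) j ->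
    agent_free s j.
  by rewrite agent_free_upd => /andP[].
have bagE k' : bag_free (State (phase2 s) None (bags s) (upd (asg s) i (Some k))) k' ->
    k' != k /\ bag_free s k'.
  move=> /forallP /= H; split; first by have := H i; rewrite /upd eqxx; apply: contra => /eqP ->.
  apply/forallP => j; have := H j; rewrite /upd; case: (j =P i) => [-> _|//].
  by move: fi; rewrite /agent_free => /eqP ->.
split=> /=.
- exact: inv_disj I.
- exact: inv_sub I.
- move=> j j' k' /updE[[-> ->]|[_ E kk]] /updE[[-> kE]|[_ E' kk']] //.
  + by rewrite eqxx in kk'.
  + by rewrite kE eqxx in kk.
  + exact: inv_inj E E'.
- by move=> j k' /updE[[-> ->] //|[_ E _]]; apply: inv_val I _ _ E.
- move=> j j' k' /freeE fj jN /updE[[-> ->]|[_ E _]] iN; last exact: inv_prio E iN.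
  by rewrite ltNge; apply: contra iN; apply: prio.
- by move=> j k' /freeE; apply: inv_bag.
- by move=> /(inv_phase1 I)[].
- by [].
- move=> k' /bagE[kk' fk'] _; apply: (inv_free I fk').
  by case: ck => ->; rewrite // (inj_eq Some_inj) eq_sym.
- by move=> p2 j k' /freeE fj /bagE[_ fk']; apply: (inv_phase2 I).
Qed.

Hypothesis v_ge0 : nonneg_vals v.
Hypothesis v_ord : ordered v.

Lemma inv_step s t : inv s -> step v delta s t -> inv t.
Proof.
move=> I st; case: st I => {s t} [s k i p1 fk mr|s p1 low|s k p2 c0 fk|s k g p2 c0 low gn gN|s k i p2 c0 mr] I.
- have [c0 _] := inv_phase1 I p1.
  by have := inv_assign I fk mr (or_introl c0); rewrite (negbTE p1).
- have [c0 bE] := inv_phase1 I p1.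
  case: I => H1 H2 H3 H4 H5 H6 H7 H8 H9 H10; split=> //= _ i k fi fk.
  by rewrite -bE; apply: low.
- case: I => H1 H2 H3 H4 H5 H6 H7 H8 H9 H10; split=> //=.
  + by move=> k' [<-].
  + by move=> k' fk' _; apply: H9 => //; rewrite c0.
  + by move=> _; apply: H10.
- have fk := inv_cur I c0.
  have asgk i k' : asg s i = Some k' -> k' != k.
    by move=> E; apply/eqP => kk; have /forallP/(_ i) := fk; rewrite E kk eqxx.
  have updk k' : k' != k -> upd (bags s) k (g |: bags s k) k' = bags s k'.
    by rewrite /upd => /negbTE ->.
  case: I => H1 H2 H3 H4 H5 H6 H7 H8 H9 H10; split=> //=.
  + move=> k1 k2 k12; rewrite /upd; case: eqP => [E1|_]; case: eqP => [E2|_]; subst.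
    * by rewrite eqxx in k12.
    * by rewrite disjoints_subset subUset sub1set inE gN -disjoints_subset H1.
    * by rewrite disjoint_sym disjoints_subset subUset sub1set inE gN -disjoints_subset H1 // eq_sym.
    * exact: H1.
  + move=> k'; rewrite /upd; case: eqP => [->|_]; last exact: H2.
    by apply: subset_trans (H2 k) _; apply: subsetUr.
  + by move=> i k' E; rewrite updk ?(asgk _ _ E) //; apply: H4.
  + by move=> i j k' fi iN E jN; rewrite updk ?(asgk _ _ E) //; apply: H5 E jN.
  + move=> i k' fi; have [->|kk] := eqVneq k' k; last by rewrite updk //; apply: H6.
    (* The initial bag is below alpha since Phase 1 ended; the enlarged one was below alpha before
       gaining a good of index at least 2n. *)
    right; split; first exact: H10.
    rewrite /upd eqxx; apply: le_trans (bvalU1_le (v_ge0 i) _ _) _.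
    have : v i g <= gval (v i) (2 * n).
      by rewrite -gvalE; apply: (gval_le (v_ge0 i) (v_ord i)).
    by have := low i fi; lra.
  + by move=> k' [<-].
  + by move=> k' fk' ck; rewrite updk; [apply: (H9 _ fk'); rewrite c0| apply: contra ck => /eqP ->].
  + by move=> _; apply: H10.
- by have := inv_assign I (inv_cur I c0) mr (or_intror c0); rewrite p2.
Qed.

Lemma inv_reach s t : inv s -> reach v delta s t -> inv t.
Proof. by move=> I r; elim: r I => // {}s {}t u st _ IH I; apply/IH/(inv_step I). Qed.

Lemma may_receive_exists s i k : agent_free s i -> alpha <= bval (v i) (bags s k) ->
  exists j, may_receive v delta s j k.
Proof.
move=> fi vi.
pose P j := [&& j \in N11 v delta, agent_free s j & alpha <= bval (v j) (bags s k)].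
have [/existsP[j /and3P[jN fj vj]]|/existsPn noP] := boolP [exists j, P j].
  by exists j; split.
exists i; split=> // j jN fj vj; have := noP j.
by rewrite /P jN fj vj.
Qed.

(** * Unassigned agents and a stuck bag; the returned allocation *)

Hypotheses (delta_ge0 : 0 <= delta) (delta_le : delta <= 11 / 1000).
Hypothesis v_norm : normalized v.
Hypothesis v_irr : irreducible v alpha.
Hypothesis N11_small : #|N11 v delta|%:R * (1 / 4 + delta / 3) <= n%:R * (1 / 4 - delta).

Lemma bval_total i : bval (v i) setT = n%:R.
Proof.
have [f [_ f1]] := v_norm i.
have -> : [set: 'I_m] = f @^-1: setT by apply/setP => g; rewrite !inE.
rewrite bval_preim (eq_bigr (fun=> 1)) => [|j _]; last exact: f1.
by rewrite sumr_const cardsT card_ord.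
Qed.

Lemma irreducible_gval i :
  gval (v i) 0 + gval (v i) (2 * n) < alpha /\ 3 * gval (v i) (2 * n) < alpha.
Proof.
have [_ H1 _ H2] := v_irr i; have n0 := ltn_ord i; split.
  move: H2; rewrite bval_items; last by rewrite /= inE; lia.
  by rewrite !big_cons big_nil addr0 addn1.
have gle := gval_le (v_ge0 i) (v_ord i).
move: H1; rewrite bval_items; last by rewrite /= !inE; lia.
rewrite !big_cons big_nil addr0 addn1.
have -> : (2 * n - 1 = (2 * n - 2).+1)%N by lia.
have E : (2 * n = (2 * n - 1).+1)%N by lia.
rewrite [in X in _ + (X + _)]E -!/(gval _ _).
have := gle (2 * n - 2)%N (2 * n)%N ltac:(lia).
have := gle (2 * n - 1)%N (2 * n)%N ltac:(lia).
by lra.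
Qed.

Lemma MMS_le1 i : MMS v i <= 1.
Proof.
have [f [<- f1]] := v_norm i.
by rewrite -[leRHS](f1 i); apply: bigmin_le.
Qed.

Lemma N11_sum_lt s i k0 : inv s -> phase2 s -> cur s = Some k0 ->
  (forall j, agent_free s j -> bval (v j) (bags s k0) < alpha) ->
  agent_free s i -> i \in N11 v delta -> \sum_k bval (v i) (bags s k) < n%:R.
Proof.
move=> I p2 c0 low fi iN.
have [_ W2n] := irreducible_gval i.
pose K := [set k | [exists j in N11 v delta, asg s j == Some k]].
have cardK : (#|K| <= #|N11 v delta|)%N.
  apply: leq_trans (leq_imset_card (fun j => odflt k0 (asg s j)) (mem (N11 v delta))).
  apply: subset_leq_card; apply/subsetP => k; rewrite inE => /existsP[j /andP[jN /eqP ak]].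
  by apply/imsetP; exists j => //; rewrite ak.
have k0K : k0 \notin K.
  rewrite inE negb_exists; apply/forallP => j; rewrite negb_and.
  by have /forallP/(_ j) -> := inv_cur I c0; rewrite orbT.
(* Such a bag is the current one, or an untouched one left over from Phase 1, or was given to an
   agent outside N^1_1. *)
have lowK k : k \notin K -> bval (v i) (bags s k) < alpha.
  move=> kK; have [fk|] := boolP (bag_free s k).
    have [->|kk] := eqVneq k k0; first exact: low.
    rewrite (inv_free I fk); first exact: (inv_phase2 I).
    by rewrite c0 (inj_eq Some_inj) eq_sym.
  rewrite negb_forall => /existsP[j]; rewrite negbK => /eqP ak.
  apply: (inv_prio I fi iN ak); apply: contra kK => jN.
  by rewrite inE; apply/existsP; exists j; rewrite jN ak eqxx.
have le_third k : bval (v i) (bags s k) <= alpha + alpha / 3.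
  case: (inv_bag I k fi) => [->|[_]]; last by lra.
  move: iN; rewrite !inE => /andP[/forallP /(_ k)]; have := delta_ge0; lra.
apply: (@lt_le_trans _ _ (\sum_k (alpha + alpha / 3 * (k \in K)%:R))).
  (* Strictness comes from the current bag. *)
  apply: (@ltr_sum1 _ _ _ _ k0) => [k|]; last by rewrite (negbTE k0K) mulr0 addr0 lowK.
  have [kK|/lowK/ltW kK] := boolP (k \in K); by rewrite ?mulr1 ?mulr0 ?addr0.
rewrite big_split /= sumr_const card_ord -mulr_sumr -natr_sum -big_mkcond /= sum1_card.
have cK : #|K|%:R <= #|N11 v delta|%:R :> R by rewrite ler_nat.
(* Since [alpha / 3 = 1/4 + delta / 3] and [1 - alpha = 1/4 - delta], this is exactly the bound on
   |N^1_1|. *)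
rewrite -mulr_natr; have := N11_small; have := delta_ge0; nra.
Qed.

Lemma N1_sum_lt s i k0 : inv s -> bval (v i) (bags s k0) < alpha ->
  agent_free s i -> i \in N1 v -> i \notin N11 v delta ->
  \sum_k bval (v i) (bags s k) < n%:R.
Proof.
move=> I low fi iN1 iN.
have -> : n%:R = \sum_(k < n) 1 :> R by rewrite sumr_const card_ord.
apply: (@ltr_sum1 _ _ _ _ k0) => [k|]; last first.
  by apply: lt_trans low _; have := delta_le; lra.
case: (inv_bag I k fi) => [->|[_]].
  by move: iN1; rewrite inE => /forallP.
(* A filled bag is worth at most [alpha + (1/4 - 5 delta) = 1 - 4 delta]. *)
move: iN; rewrite inE iN1 /= -ltNge addn1 -/(gval _ _); have := delta_ge0; lra.
Qed.

Lemma N2_sum_lt s i : inv s -> agent_free s i -> i \notin N1 v ->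
  \sum_k bval (v i) (bags s k) < n%:R.
Proof.
move=> I fi; rewrite inE negb_forall => /existsP[k]; rewrite -ltNge => big_k.
have [f [_ f1]] := v_norm i; have [W02n _] := irreducible_gval i.
apply: (sum_large_bag_lt (v_ge0 i) (v_ord i) f1 delta_ge0 delta_le W02n _ big_k) => k'.
by case: (inv_bag I k' fi) => [->|]; [left|right].
Qed.

Lemma unused_good_exists s k : inv s -> phase2 s -> cur s = Some k ->
  (forall j, agent_free s j -> bval (v j) (bags s k) < alpha) ->
  exists2 g : 'I_m, (2 * n < g.+1)%N & forall k', g \notin bags s k'.
Proof.
move=> I p2 c0 low.
have [/existsP[g /andP[gn /forallP gN]]|/existsPn used] :=
  boolP [exists g : 'I_m, (2 * n < g.+1)%N && [forall k', g \notin bags s k']].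
  by exists g.
have /forallP fk := inv_cur I c0.
have [i fi] := free_bag_free_agent (inv_inj I) fk.
suff lt_n : \sum_k' bval (v i) (bags s k') < n%:R.
  suff : bval (v i) setT <= \sum_k' bval (v i) (bags s k') by rewrite bval_total; lra.
  apply: (bval_cover (v_ge0 i)) => g; have := used g; rewrite negb_and => /orP[gn|].
    (* A good among the first 2n lies in the initial bag indexed by the smaller of itself and its
       partner, and bags only grow. *)
    have kn : (minn g (2 * n - 1 - g) < n)%N by lia.
    exists (Ordinal kn); apply: (subsetP (inv_sub I _)); rewrite !inE /=; lia.
  by rewrite negb_forall => /existsP[k']; rewrite negbK; exists k'.
have [iN|iN] := boolP (i \in N11 v delta); first exact: N11_sum_lt low fi iN.
have [iN1|iN1] := boolP (i \in N1 v); last exact: N2_sum_lt.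
exact: N1_sum_lt (low i fi) fi iN1 iN.
Qed.

Lemma stuck_terminated s : inv s -> (forall t, ~ step v delta s t) -> terminated s.
Proof.
move=> I stuck; have [p2|p1] := boolP (phase2 s); last first.
  case: (stuck _ (step_to_phase2 p1 _)) => i k fi fk.
  rewrite ltNge; apply/negP => vi.
  have [j mr] := may_receive_exists fi vi.
  exact: stuck _ (step_phase1 p1 fk mr).
case c0 : (cur s) => [k|]; last first.
  split=> //; split=> // k; apply/negP => fk.
  exact: stuck _ (step_pick v delta p2 c0 fk).
have low j : agent_free s j -> bval (v j) (bags s k) < alpha.
  move=> fj; rewrite ltNge; apply/negP => vj.
  have [j' mr] := may_receive_exists fj vj.
  exact: stuck _ (step_assign p2 c0 mr).
have [g gn gN] := unused_good_exists I p2 c0 low.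
by case: (stuck _ (step_add p2 c0 low gn gN)).
Qed.

Lemma terminated_MMS s : inv s -> terminated s -> is_beta_MMS v alpha (output s).
Proof.
move=> I [_ [_ full]].
have {}full : forall i, exists k, asg s i = Some k.
  apply: full_bags_full_agents => k; have := full k.
  by rewrite negb_forall => /existsP[i]; rewrite negbK; exists i.
split=> [i j ij|i].
  have [[k ik] [k' jk]] := (full i, full j); rewrite /output ik jk.
  apply: (inv_disj I); apply: contra ij => /eqP kk; apply/eqP.
  by apply: (inv_inj I ik); rewrite kk.
have [k ik] := full i; rewrite /output ik; apply: le_trans (inv_val I ik).
by have := MMS_le1 i; have := delta_ge0; nra.
Qed.

End Run.

Theorem theorem29 (R : realFieldType) (n m : nat) (v : 'I_n -> 'I_m -> R)
    (delta : R) :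
  0 <= delta -> delta <= 11 / 1000 ->
  ONI v delta ->
  #|N11 v delta|%:R <= n%:R * (1/4 - delta) / (1/4 + delta / 3) ->
  (* every run of approxMMS1 is finite ... *)
  Acc (fun t s => step v delta s t) (@init_state n m) /\
  (* ... and every run that cannot continue has returned a (3/4+delta)-MMS
     allocation *)
  (forall s, reach v delta (@init_state n m) s ->
     (forall t, ~ step v delta s t) ->
     terminated s /\ is_beta_MMS v (3/4 + delta) (output s)).
Proof.
move=> d0 d1 [v0 vo vn vi] small; split; first exact: step_wf.
move=> s rs stuck; have I := inv_reach v0 vo (inv_init v delta) rs.
rewrite ler_pdivlMr in small; last by lra.
have term := stuck_terminated v0 vo d0 d1 vn vi small I stuck.
by split; [|exact: terminated_MMS].
Qed.
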